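(* Let $Y$ be a finite-dimensional subspace of the real Banach space $c_0$. Then $Y$ has property-$(SU)$ in $c_0$ if and only if $Y$ has property-$(U)$ in $c_0$ and $Y$ is isometrically isomorphic to $\ell_\infty(\dim(Y))$.
   Context: $\ell_\infty(n)$ is $\mathbb{R}^n$ with the maximum norm. For a closed subspace $Y$ of a Banach space $X$, $Y^\perp=\{x^*\in X^*: x^*(y)=0\ \forall y\in Y\}$. $Y$ has property-$(U)$ in $X$ if every bounded linear functional on $Y$ has a unique norm-preserving extension to $X$. $Y$ has property-$(SU)$ in $X$ if there is a closed subspace $G$ of $X^*$ with $X^*=G\oplus Y^\perp$ such that for each $x^*\in X^*$, $\|x^*\|>\|y^\#\|$ whenever $x^*=y^\#+y^\perp$ with $y^\#\in G$ and $0\neq y^\perp\in Y^\perp$. *)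

(* Defs.v *)
From HB Require Import structures.
From mathcomp Require Import all_boot all_order all_algebra.
From mathcomp Require Import all_classical all_reals all_analysis.

Set Implicit Arguments.
Unset Strict Implicit.
Unset Printing Implicit Defensive.

Import Order.TTheory GRing.Theory Num.Theory.
Import numFieldNormedType.Exports.

Local Open Scope classical_set_scope.
Local Open Scope ring_scope.

Section C0.
Variable R : realType.

Definition null_seq : {pred nat -> R} := mem [set u : nat -> R | u @ \oo --> 0].

Lemma null_seqP (u : nat -> R) : (u \in null_seq) <-> (u @ \oo --> 0).
Proof. by split=> [/[!inE]|h]; rewrite ?inE. Qed.

Lemma null_seq_submod_closed : submod_closed null_seq.
Proof.
split; first by apply/null_seqP; exact: cvg_cst.
move=> a u v /null_seqP u0 /null_seqP v0; apply/null_seqP.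
by rewrite -[0](addr0 0) -{1}(mulr0 a); apply: cvgD => //; exact: cvgZl_tmp.
Qed.

HB.instance Definition _ :=
  GRing.isSubmodClosed.Build R (nat -> R) null_seq null_seq_submod_closed.

Record c0 : Type := C0 { c0_seq :> nat -> R; c0_seqP : c0_seq \in null_seq }.

HB.instance Definition _ := [isSub for c0_seq].
HB.instance Definition _ := [Choice of c0 by <:].
HB.instance Definition _ := [SubChoice_isSubLmodule of c0 by <:].

Definition c0_norm (u : c0) : R := sup (range (fun n => `|u n|)).

Lemma c0_cvg (u : c0) : (u : nat -> R) @ \oo --> 0.
Proof. exact/null_seqP/c0_seqP. Qed.

Lemma c0_has_ub (u : c0) : has_ubound (range (fun n => `|u n|)).
Proof.
have /cvg_seq_bounded/pinfty_ex_gt0[M M0 uM] : cvgn (u : nat -> R).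
  by apply/cvg_ex; exists 0; exact: c0_cvg.
by exists M => _ [n _ <-]; exact: uM.
Qed.

Lemma c0_norm_ge (u : c0) n : `|u n| <= c0_norm u.
Proof. by apply: ub_le_sup; [exact: c0_has_ub|exists n]. Qed.

Lemma c0_norm_le (u : c0) M : (forall n, `|u n| <= M) -> c0_norm u <= M.
Proof.
move=> uM; apply: ge_sup; first by exists `|u 0|, 0.
by move=> _ [n _ <-].
Qed.

Lemma c0_normD (u v : c0) : c0_norm (u + v) <= c0_norm u + c0_norm v.
Proof.
apply: c0_norm_le => n; rewrite (le_trans (ler_normD _ _))// lerD//;
  exact: c0_norm_ge.
Qed.

Lemma c0_normZ (a : R) (u : c0) : c0_norm (a *: u) = `|a| * c0_norm u.
Proof.
have le b v : c0_norm (b *: v) <= `|b| * c0_norm v.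
  by apply: c0_norm_le => n; rewrite normrM ler_wpM2l// c0_norm_ge.
apply/eqP; rewrite eq_le le/=; have [->|a0] := eqVneq a 0.
  by rewrite normr0 mul0r (le_trans _ (c0_norm_ge _ 0%N)).
rewrite -ler_pdivlMl ?normr_gt0// -normfV.
by rewrite -{1}[u]scale1r -(mulVf a0) -scalerA le.
Qed.

Lemma c0_norm_eq0 (u : c0) : c0_norm u = 0 -> u = 0.
Proof.
move=> u0; apply/val_inj/funext => n; apply/eqP.
by rewrite -normr_le0 -u0; exact: c0_norm_ge.
Qed.

HB.instance Definition _ :=
  Lmodule_isNormed.Build R c0 c0_normD c0_normZ c0_norm_eq0.

Lemma c0_complete (F : set_system c0) : ProperFilter F -> cauchy F -> cvg F.
Proof.
move=> FF Fc.
have coord n : cvg (((fun u : c0 => u n) @ F) : set_system R).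
  apply: cauchy_cvg; apply/cauchy_ballP => e e0.
  have /cauchy_ballP/(_ _ e0) := Fc.
  rewrite !near_simpl => -[[A B] [FA FB] AB].
  exists ((fun u : c0 => u n) @` A, (fun u : c0 => u n) @` B) => /=.
    by split; [apply: filterS FA|apply: filterS FB] => u; exists u.
  move=> [_ _] [/= [u Au <-] [v Bv <-]].
  have /= := AB (u, v) (conj Au Bv).
  rewrite -!ball_normE/= => /(le_lt_trans _); apply.
  exact: (c0_norm_ge (u - v)).
pose l n := lim (((fun u : c0 => u n) @ F) : set_system R).
have unif e : 0 < e -> F [set u : c0 | forall n, `|l n - u n| <= e].
  move=> e0; have /cauchy_ballP/(_ _ e0) := Fc.
  move=> -[[A B] [FA FB] AB]; apply: filterS FB => v Bv n.
  have cl : (fun u : c0 => u n) @ F --> l n by exact: coord.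
  have cv : (fun u : c0 => `|u n - v n|) @ F --> `|l n - v n|.
    by apply: cvg_norm; apply: cvgB cl _; exact: cvg_cst.
  apply: (cvgr_to_le cv).
  apply: filterS FA => u Au.
  have /= := AB (u, v) (conj Au Bv).
  rewrite -!ball_normE/= => /ltW; apply: le_trans.
  exact: (c0_norm_ge (u - v)).
have l0 : l \in null_seq.
  apply/null_seqP/cvgrPdist_le => e e0.
  have e2 : 0 < e / 2 by rewrite divr_gt0.
  have [u ue] := filter_ex (unif _ e2).
  have /cvgrPdist_le/(_ _ e2) := @c0_cvg u.
  apply: filterS => n; rewrite !sub0r !normrN => un.
  rewrite -(subrK (u n) (l n)) (splitr e).
  by rewrite (le_trans (ler_normD _ _))// lerD.
apply/cvg_ex; exists (C0 l0); apply/cvgrPdist_le => e e0.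
apply: filterS (unif _ e0) => u ue.
exact: (c0_norm_le (u := C0 l0 - u)).
Qed.

HB.instance Definition _ := Uniform_isComplete.Build c0 c0_complete.

End C0.

Section Dual.
Variables (R : realType) (X : normedModType R).

Definition bounded_functional : {pred X -> R} :=
  mem [set f : X -> R | linear f /\ exists M, forall x, `|f x| <= M * `|x|].

Lemma bounded_functional_submod_closed : submod_closed bounded_functional.
Proof.
split.
  apply/mem_set; split; first by move=> a x y; rewrite /= scaler0 addr0.
  by exists 0 => x; rewrite normr0 mul0r.
move=> a f g /set_mem[fl [M fM]] /set_mem[gl [N gN]]; apply/mem_set; split.
  move=> b x y.
  change (a * f (b *: x + y) + g (b *: x + y) =
          b * (a * f x + g x) + (a * f y + g y)).
  have -> : f (b *: x + y) = b * f x + f y by exact: fl.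
  have -> : g (b *: x + y) = b * g x + g y by exact: gl.
  by rewrite !mulrDr !mulrA (mulrC b a) addrACA.
exists (`|a| * M + N) => x; rewrite mulrDl -mulrA.
rewrite (le_trans (ler_normD _ _))// lerD//.
by rewrite normrM ler_wpM2l.
Qed.

HB.instance Definition _ := GRing.isSubmodClosed.Build R (X -> R)
  bounded_functional bounded_functional_submod_closed.

(* The canonical norm below is the operator norm, so that `closed` and `|_|
   on dual X refer to the norm topology. *)
Record dual : Type :=
  Dual { dual_fun :> X -> R; dual_funP : dual_fun \in bounded_functional }.

HB.instance Definition _ := [isSub for dual_fun].
HB.instance Definition _ := [Choice of dual by <:].
HB.instance Definition _ := [SubChoice_isSubLmodule of dual by <:].

Lemma dual_linear (f : dual) : linear f.
Proof. by have /set_mem[] := dual_funP f. Qed.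

HB.instance Definition _ (f : dual) :=
  GRing.isLinear.Build R X R _ (dual_fun f) (dual_linear f).

Definition dual_norm (f : dual) : R :=
  sup [set `|f x| | x in [set x : X | `|x| <= 1]].

Lemma dual_has_ub (f : dual) :
  has_ubound [set `|f x| | x in [set x : X | `|x| <= 1]].
Proof.
have /set_mem[_ [M fM]] := dual_funP f.
exists `|M| => _ [x /= x1 <-]; rewrite (le_trans (fM x))//.
rewrite (@le_trans _ _ (`|M| * `|x|))//; first by rewrite ler_wpM2r// ler_norm.
by rewrite -[leRHS]mulr1 ler_wpM2l.
Qed.

Lemma dual_norm_ge (f : dual) x : `|f x| <= dual_norm f * `|x|.
Proof.
have [->|x0] := eqVneq x 0; first by rewrite linear0 !normr0 mulr0.
have nx : 0 < `|x| by rewrite normr_gt0.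
rewrite -ler_pdivrMr//; apply: ub_le_sup; first exact: dual_has_ub.
exists (`|x|^-1 *: x); rewrite /= ?normrZ ?normfV ?normr_id ?mulVf ?gt_eqF//.
by rewrite linearZ/= normrM normfV normr_id mulrC.
Qed.

Lemma dual_norm_le (f : dual) M :
  (forall x, `|x| <= 1 -> `|f x| <= M) -> dual_norm f <= M.
Proof.
move=> fM; apply: ge_sup; first by exists `|f 0|, 0; rewrite //= normr0.
by move=> _ [x /= /fM + <-].
Qed.

Lemma dual_norm_ge1 (f : dual) x : `|x| <= 1 -> `|f x| <= dual_norm f.
Proof. by move=> x1; apply: ub_le_sup; [exact: dual_has_ub|exists x]. Qed.

Lemma dual_normD (f g : dual) : dual_norm (f + g) <= dual_norm f + dual_norm g.
Proof.
apply: dual_norm_le => x x1; rewrite (le_trans (ler_normD _ _))// lerD//;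
  exact: dual_norm_ge1.
Qed.

Lemma dual_normZ (a : R) (f : dual) : dual_norm (a *: f) = `|a| * dual_norm f.
Proof.
have le b g : dual_norm (b *: g) <= `|b| * dual_norm g.
  by apply: dual_norm_le => x x1; rewrite normrM ler_wpM2l// dual_norm_ge1.
apply/eqP; rewrite eq_le le/=; have [->|a0] := eqVneq a 0.
  by rewrite normr0 mul0r (le_trans _ (dual_norm_ge1 _ (x := 0) _))// normr0.
rewrite -ler_pdivlMl ?normr_gt0// -normfV.
by rewrite -{1}[f]scale1r -(mulVf a0) -scalerA le.
Qed.

Lemma dual_norm_eq0 (f : dual) : dual_norm f = 0 -> f = 0.
Proof.
move=> f0; apply/val_inj/funext => x; apply/eqP.
by rewrite -normr_le0 (le_trans (dual_norm_ge _ _))// f0 mul0r.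
Qed.

HB.instance Definition _ :=
  Lmodule_isNormed.Build R dual dual_normD dual_normZ dual_norm_eq0.

End Dual.

Section Subspace.
Variables (R : realType) (X : normedModType R) (Y : submodClosed X).

(* The subspace Y as a normed space of its own, with the norm of X. *)
Record subsp : Type := Subsp { subsp_val :> X; subsp_valP : subsp_val \in Y }.

HB.instance Definition _ := [isSub for subsp_val].
HB.instance Definition _ := [Choice of subsp by <:].
HB.instance Definition _ := [SubChoice_isSubLmodule of subsp by <:].

Definition subsp_norm (y : subsp) : R := `|y : X|.

Lemma subsp_normD (y z : subsp) :
  subsp_norm (y + z) <= subsp_norm y + subsp_norm z.
Proof. exact: ler_normD. Qed.

Lemma subsp_normZ (a : R) (y : subsp) :
  subsp_norm (a *: y) = `|a| * subsp_norm y.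
Proof. exact: normrZ. Qed.

Lemma subsp_norm_eq0 (y : subsp) : subsp_norm y = 0 -> y = 0.
Proof. by move=> y0; apply/val_inj/normr0_eq0. Qed.

HB.instance Definition _ :=
  Lmodule_isNormed.Build R subsp subsp_normD subsp_normZ subsp_norm_eq0.

End Subspace.

Definition annihilator (R : realType) (X : normedModType R)
    (Y : submodClosed X) : set (dual X) :=
  [set f | forall y, y \in Y -> f y = 0].

Definition direct_sum (V : zmodType) (A B : set V) :=
  forall x, exists! p : V * V, [/\ A p.1, B p.2 & x = p.1 + p.2].

Definition isometrically_isomorphic (R : realType) (V W : normedModType R) :=
  exists T : {linear V -> W}, bijective T /\ forall v, `|T v| = `|v|.

(* The library norm on 'rV[R]_n is the maximum norm (mx_normrE). *)
Definition linfty (R : realType) (n : nat) : normedModType R := 'rV[R]_n.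

(* n vectors of V form a basis; n is determined by V, and 0 is allowed. *)
Definition has_dim (R : realType) (V : lmodType R) (n : nat) :=
  exists e : 'I_n -> V,
    forall v, exists! c : 'I_n -> R, v = \sum_(i < n) c i *: e i.

Definition property_U (R : realType) (X : normedModType R)
    (Y : submodClosed X) :=
  forall f : dual (subsp Y), exists! g : dual X,
    (forall y : subsp Y, g y = f y) /\ `|g| = `|f|.

Definition property_SU (R : realType) (X : normedModType R)
    (Y : submodClosed X) :=
  exists G : submodClosed (dual X),
    [/\ closed [set` G],
        direct_sum [set` G] (annihilator Y) &
        forall f g h : dual X,
          g \in G -> annihilator Y h -> h <> 0 -> f = g + h -> `|f| > `|g| ].

(* Main.v *)
Require Import Defs.
From HB Require Import structures.
From mathcomp Require Import all_boot all_order all_algebra.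
From mathcomp Require Import all_classical all_reals all_analysis.

Set Implicit Arguments.
Unset Strict Implicit.
Unset Printing Implicit Defensive.

Import Order.TTheory GRing.Theory Num.Theory.
Import numFieldNormedType.Exports.

Local Open Scope classical_set_scope.
Local Open Scope ring_scope.

(** Property-(SU) says that the norm-preserving extensions of functionals on
    [Y] are unique and depend linearly on the functional: the complement [G]
    is the set of those extensions.  So everything rests on exhibiting
    extensions that are visibly linear, which is possible when [Y] is a copy
    of l-infinity.

    If [T] is an isometry of [Y] onto l-infinity and [b k] is the preimage of
    the [k]-th unit vector, then a functional [f] on [Y] has the l1-norm of the
    numbers [f (b k)].  Once every coordinate of [T] is the restriction of some
    [g k] of norm at most 1, the map sending [f] to the sum of the
    [f (b k) *: g k] is therefore a linear norm-preserving extension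
    ([linfty_linear_extension]).  This holds in any normed space, and with
    property-(U) it gives property-(SU): (U) provides the [g k], and its
    uniqueness part gives the strict inequality ([property_U_SU]).

    Conversely, assume property-(SU) with complement [G].  A functional whose
    norm is not lowered by restriction to [Y] has no annihilator component,
    because removing a nonzero one would lower its norm without changing its
    restriction; hence it lies in [G] ([norm_preserving_in_complement]).  In
    [c0] this applies to the evaluation at every coordinate [i] at which some
    nonzero [y] in [Y] attains its norm.  As [G] meets the annihilator of [Y]
    in 0 and evaluations at distinct coordinates are independent on [c0], the
    evaluations at such norming coordinates remain independent on [Y]; so
    there are at most [n] of them
    ([norming_coordinates_independent]).  On the other hand a null sequence
    attains its norm, so the norm of each [y] is the largest modulus of its
    entries at the norming coordinates: reading these entries embeds [Y] isometrically
    into l-infinity, and independence makes the embedding onto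
    ([property_SU_norming_coordinates]).  Evaluations have norm at most 1 on
    the whole of [c0], hence every functional on [Y] has a norm-preserving
    extension by the construction above, with no appeal to Hahn-Banach, and
    its uniqueness is a formal consequence of property-(SU)
    ([property_SU_U]). *)

(** * Functionals on a normed space *)

Definition mk_dual {R : realType} {X : normedModType R} (f : X -> R)
    (fL : linear f) {M : R} (fM : forall x, `|f x| <= M * `|x|) : dual X :=
  Dual (mem_set (conj fL (ex_intro _ M fM))).

Lemma dual_ler_norm (R : realType) (X : normedModType R) (f : dual X) x :
  `|f x| <= `|f| * `|x|.
Proof. exact: dual_norm_ge. Qed.

Lemma dual_norm_bound (R : realType) (X : normedModType R) (f : dual X) M :
  0 <= M -> (forall x, `|f x| <= M * `|x|) -> `|f| <= M.
Proof.
move=> M0 fM; apply: dual_norm_le => x x1.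
by rewrite (le_trans (fM x))// -[leRHS]mulr1 ler_wpM2l.
Qed.

Lemma dual_eqP (R : realType) (X : normedModType R) (f g : dual X) :
  (forall x, f x = g x) -> f = g.
Proof. by move=> fg; apply/val_inj/funext. Qed.

Lemma dual_sumE (R : realType) (X : normedModType R) (n : nat) (c : 'I_n -> R)
    (g : 'I_n -> dual X) x :
  (\sum_(k < n) c k *: g k) x = \sum_(k < n) c k * g k x.
Proof.
elim/big_ind2: _ => //= f1 a1 f2 a2 <- <-.
by [].
Qed.

Lemma restriction_linear (R : realType) (X : normedModType R)
  (Y : submodClosed X) (g : dual X) : linear (fun y : subsp Y => g (y : X)).
Proof. by move=> a y z; exact: dual_linear. Qed.

Definition restriction {R : realType} {X : normedModType R}
    (Y : submodClosed X) (g : dual X) : dual (subsp Y) :=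
  mk_dual (restriction_linear g) (fun y : subsp Y => dual_ler_norm g y).

Lemma restrictionE (R : realType) (X : normedModType R) (Y : submodClosed X)
  (g : dual X) (y : subsp Y) : restriction Y g y = g y.
Proof. by []. Qed.

Lemma restriction_linearP (R : realType) (X : normedModType R)
    (Y : submodClosed X) : linear (@restriction R X Y).
Proof. by move=> a f g; exact: dual_eqP. Qed.

HB.instance Definition _ (R : realType) (X : normedModType R)
    (Y : submodClosed X) :=
  GRing.isLinear.Build R (dual X) (dual (subsp Y)) _ (@restriction R X Y)
    (@restriction_linearP R X Y).

Lemma restriction_norm_le (R : realType) (X : normedModType R)
  (Y : submodClosed X) (g : dual X) : `|restriction Y g| <= `|g|.
Proof. by apply: dual_norm_bound => // y; exact: (dual_ler_norm g (y : X)). Qed.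

Lemma annihilatorP (R : realType) (X : normedModType R)
  (Y : submodClosed X) (h : dual X) :
  annihilator Y h <-> forall y : subsp Y, h y = 0.
Proof.
split=> [hY y|hY y yY]; first exact/hY/subsp_valP.
exact: (hY (Subsp yY)).
Qed.

(** * Norm-preserving extensions and property-(SU) *)

Lemma complement_annihilator_eq0 (R : realType) (X : normedModType R)
    (Y : submodClosed X) (G : submodClosed (dual X)) (h : dual X) :
  direct_sum [set` G] (annihilator Y) -> h \in G -> annihilator Y h -> h = 0.
Proof.
move=> GY hG hY; have [p [_ pu]] := GY h.
have p1 : p = (h, 0).
  by apply: pu; split => //=; rewrite ?addr0.
have p2 : p = (0, h).
  by apply: pu; split => //=; rewrite ?add0r ?inE ?rpred0.
by move: p1; rewrite p2 => -[].
Qed.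

(** Write [g = g1 + h] with [h] in the annihilator.  The restrictions of [g] and
    [g1] agree, so [|g|] is at most [|g1|], and the strict inequality forces
    [h = 0]. *)
Lemma norm_preserving_in_complement (R : realType) (X : normedModType R)
    (Y : submodClosed X) (G : submodClosed (dual X)) (g : dual X) :
  direct_sum [set` G] (annihilator Y) ->
  (forall f g h : dual X, g \in G -> annihilator Y h -> h <> 0 ->
     f = g + h -> `|f| > `|g|) ->
  `|g| <= `|restriction Y g| -> g \in G.
Proof.
move=> GY lt gY; have [[g1 h] [[/= g1G hY gE] _]] := GY g.
have [h0|h0] := pselect (h = 0); first by rewrite gE h0 addr0.
have := lt _ _ _ g1G hY h0 gE; rewrite ltNge => /negP[].
apply: (le_trans gY).
suff -> : restriction Y g = restriction Y g1 by exact: restriction_norm_le.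
apply: dual_eqP => y; rewrite !restrictionE gE.
by rewrite -[RHS]addr0 -((annihilatorP _ _).1 hY y).
Qed.

(** Norm-preserving extensions all belong to [G], and two extensions of one
    functional differ by an element of the annihilator.  Only their existence
    has to be supplied. *)
Lemma property_SU_U (R : realType) (X : normedModType R) (Y : submodClosed X) :
  property_SU Y ->
  (forall f : dual (subsp Y), exists2 g : dual X,
     forall y : subsp Y, g y = f y & `|g| <= `|f|) ->
  property_U Y.
Proof.
move=> [G [_ GY lt]] ext f.
have inG (g : dual X) :
    (forall y : subsp Y, g y = f y) -> `|g| <= `|f| -> g \in G.
  move=> gf gle; apply: (norm_preserving_in_complement GY lt).
  by rewrite (_ : restriction Y g = f)//; exact: dual_eqP.
have [g gf gle] := ext f; exists g; split.
  split=> //; apply/eqP; rewrite eq_le gle/=.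
  rewrite (_ : f = restriction Y g) ?restriction_norm_le//.
  by apply: dual_eqP => y; rewrite restrictionE.
move=> g' [g'f g'E]; apply/eqP; rewrite -subr_eq0; apply/eqP.
apply: (complement_annihilator_eq0 GY).
  by rewrite -scaleN1r rpredD ?rpredZ// inG// g'E.
apply/annihilatorP => y.
by transitivity (g y - g' y) => //; rewrite gf g'f subrr.
Qed.

(** The complement is the range of [L], described as the fixed points of the
    projection [g |-> L (restriction Y g)], whose kernel is the annihilator.
    If adding [h] to an element of the range did not increase its norm, the sum
    would be a second norm-preserving extension of the same functional. *)
Lemma property_U_SU (R : realType) (X : normedModType R) (Y : submodClosed X)
    (L : {linear dual (subsp Y) -> dual X}) :
  (forall f (y : subsp Y), L f y = f y) -> (forall f, `|L f| <= `|f|) ->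
  property_U Y -> property_SU Y.
Proof.
move=> Lext Lle YU.
have rL f : restriction Y (L f) = f by apply: dual_eqP => y; exact: Lext.
have rle g : `|restriction Y g| <= `|g| by exact: restriction_norm_le.
pose S : {pred dual X} := mem [set g | L (restriction Y g) = g].
have SP g : g \in S <-> L (restriction Y g) = g by split=> [/set_mem|/mem_set].
have S_submod : submod_closed S.
  split; first by apply/SP; rewrite !linear0.
  by move=> a u v /SP uS /SP vS; apply/SP; rewrite !linearP uS vS.
pose G : submodClosed (dual X) :=
  HB.pack S (GRing.isSubmodClosed.Build R (dual X) S S_submod).
have SG g : g \in G <-> L (restriction Y g) = g by exact: SP.
have rY h : annihilator Y h <-> restriction Y h = 0.
  split=> [/annihilatorP hY|h0]; first exact: dual_eqP.
  apply/annihilatorP => y.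
  exact: (congr1 (fun f : dual (subsp Y) => f y) h0).
exists G; split.
  (* The projection has norm at most 1, so a point at distance less than e/2
     from its range is moved by at most e. *)
- move=> /= g gcl; apply/SG/eqP; rewrite -subr_eq0 -normr_le0.
  apply/ler_addgt0Pr => e e0; rewrite add0r.
  have [g' [/= /SG g'G]] :=
    gcl _ (nbhsx_ballx g (e / 2) (divr_gt0 e0 (ltr0Sn R 1))).
  rewrite -ball_normE/= => gg'.
  have -> : L (restriction Y g) - g = L (restriction Y (g - g')) - (g - g').
    by rewrite (linearB (@restriction R X Y)) linearB g'G opprB addrA subrK.
  rewrite (le_trans (ler_normB _ _))// (splitr e) lerD ?ltW//.
  by rewrite (le_lt_trans (Lle _))// (le_lt_trans (rle _)).
- move=> g; exists (L (restriction Y g), g - L (restriction Y g)); split=> /=.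
    split; first by apply/SG; rewrite rL.
      by apply/rY; rewrite linearB/= rL subrr.
    by rewrite addrC subrK.
  move=> [g1 h] [/= /SG g1G /rY hY ->].
  by rewrite linearD/= hY addr0 g1G addrAC subrr add0r.
- move=> f g h /SG gG /rY hY h0 fE.
  have rf : restriction Y f = restriction Y g by rewrite fE linearD/= hY addr0.
  have gle : `|g| <= `|restriction Y g|.
    by have := Lle (restriction Y g); rewrite gG.
  rewrite lt_neqAle (le_trans gle) -?rf// andbT.
  apply/eqP => gf; apply: h0.
  have [k [_ ku]] := YU (restriction Y g).
  have kg : k = g.
    by apply: ku; split=> //; apply/eqP; rewrite eq_le gle rle.
  have kf : k = f.
    apply: ku; split; first by move=> y; rewrite -rf.
    by rewrite -gf; apply/eqP; rewrite eq_le gle rle.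
  by apply: (@addrI _ g); rewrite -fE addr0 -kg kf.
Qed.

(** * Functionals on copies of finite-dimensional l-infinity *)

Lemma row_norm_le (R : realType) (n : nat) (v : 'rV[R]_n) M :
  0 <= M -> (forall k, `|v 0 k| <= M) -> `|v| <= M.
Proof.
move=> M0 vM; have -> : `|v| = mx_norm v by [].
by rewrite mx_normrE; apply: bigmax_le => // -[i k] _ /=; rewrite ord1.
Qed.

Lemma row_norm_ge (R : realType) (n : nat) (v : 'rV[R]_n) k : `|v 0 k| <= `|v|.
Proof.
have -> : `|v| = mx_norm v by [].
by rewrite mx_normrE; exact: (le_bigmax _ (fun ij => `|v ij.1 ij.2|) (0, k)).
Qed.

(** The norm of [f] dominates the l1-norm of the [f (b k)]: test [f] on the
    combination of the [b k] whose coefficients are the signs of the [f (b k)],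
    a vector of norm at most 1. *)
Lemma linfty_linear_extension (R : realType) (X : normedModType R)
    (Y : submodClosed X) (n : nat) (T : {linear subsp Y -> linfty R n})
    (g : 'I_n -> dual X) :
  bijective T -> (forall y, `|T y| = `|y|) ->
  (forall k, `|g k| <= 1) -> (forall k (y : subsp Y), g k y = T y 0 k) ->
  exists L : {linear dual (subsp Y) -> dual X},
    (forall f (y : subsp Y), L f y = f y) /\ forall f, `|L f| <= `|f|.
Proof.
move=> [Ti TK TiK] Tiso g1 gT.
pose b k : subsp Y := Ti 'e_k.
have Tcomb (c : 'I_n -> R) : T (\sum_(k < n) c k *: b k) = \row_k c k.
  rewrite linear_sum [RHS]row_sum_delta; apply: eq_bigr => k _.
  by rewrite linearZ/= TiK mxE.
have decomp y : y = \sum_(k < n) T y 0 k *: b k.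
  by apply: (can_inj TK); rewrite Tcomb; apply/rowP => k; rewrite mxE.
pose L0 (f : dual (subsp Y)) := \sum_(k < n) f (b k) *: g k.
have L0lin : linear L0.
  move=> a f1 f2; rewrite scaler_sumr -big_split/=; apply: eq_bigr => k _.
  by rewrite scalerA -scalerDl.
pose L : {linear dual (subsp Y) -> dual X} :=
  HB.pack L0 (GRing.isLinear.Build _ _ _ _ L0 L0lin).
exists L; split=> /=.
- move=> f y; rewrite /L0 dual_sumE {2}(decomp y) linear_sum.
  by apply: eq_bigr => k _; rewrite linearZ/= gT mulrC.
- move=> f; have -> : `|f| = `|f| * 1 by rewrite mulr1.
  have le1 : `|\sum_(k < n) Num.sg (f (b k)) *: b k| <= 1.
    rewrite -Tiso Tcomb; apply: row_norm_le => // k.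
    by rewrite mxE normr_sg; case: (_ == _).
  apply: le_trans (ler_wpM2l (normr_ge0 f) le1).
  apply: le_trans (dual_ler_norm f _).
  rewrite (le_trans (ler_norm_sum _ _ _))//.
  rewrite (le_trans _ (ler_norm _))// linear_sum/= ler_sum// => k _.
  have -> : f (Num.sg (f (b k)) *: b k) = `|f (b k)|.
    by rewrite linearZ normrEsg.
  by rewrite normrZ -[leRHS]mulr1 ler_wpM2l.
Qed.

Lemma coordinate_linear (R : realType) (V : lmodType R) (n : nat)
    (T : {linear V -> 'rV[R]_n}) (k : 'I_n) :
  linear (fun v => T v 0 k).
Proof. by move=> a u v; rewrite linearP !mxE. Qed.

Lemma property_U_linfty_SU (R : realType) (X : normedModType R)
    (Y : submodClosed X) (n : nat) :
  property_U Y -> isometrically_isomorphic (subsp Y) (linfty R n) ->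
  property_SU Y.
Proof.
move=> YU [T [Tbij Tiso]].
have coord k : exists g : dual X,
    `|g| <= 1 /\ forall y : subsp Y, g y = T y 0 k.
  have Tle y : `|T y 0 k| <= 1 * `|y|.
    by rewrite mul1r -Tiso; exact: row_norm_ge.
  pose e := mk_dual
    (coordinate_linear (T : {linear subsp Y -> 'rV[R]_n}) k) Tle.
  have [g [[ge gn] _]] := YU e; exists g; split=> //.
  by rewrite gn dual_norm_bound.
have /choice [g gP] := coord.
have [|L [Lext Lle]] :=
    linfty_linear_extension Tbij Tiso _ (fun k => (gP k).2).
  by move=> k; have [] := gP k.
exact: property_U_SU Lext Lle YU.
Qed.

(** * Linear maps into a coordinate space *)

(** In a basis of [V] the map [T] becomes an [n] by [m] matrix, and the absence
    of linear relations among the coordinates of [T] says that its columns are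
    independent. *)
Lemma dim_ge_independent_coordinates (R : realType) (V : lmodType R)
    (n m : nat) (T : {linear V -> 'rV[R]_m}) :
  has_dim V n ->
  (forall c : 'I_m -> R, (forall v, \sum_(k < m) c k * T v 0 k = 0) ->
     forall k, c k = 0) ->
  (m <= n)%N /\ (injective T -> bijective T /\ m = n).
Proof.
move=> [e eP] Tind; pose A := \matrix_(j < n) T (e j).
have TA (c : 'I_n -> R) : T (\sum_(j < n) c j *: e j) = (\row_j c j) *m A.
  rewrite linear_sum mulmx_sum_row; apply: eq_bigr => j _.
  by rewrite linearZ/= rowK mxE.
have Afull : row_full A.
  suff : row_free A^T by rewrite /row_free mxrank_tr.
  apply: inj_row_free => c cA.
  apply/rowP => k; rewrite mxE; apply: (Tind (fun k => c 0 k)) => v.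
  have [d [-> _]] := eP v.
  rewrite TA; transitivity ((\row_j d j *m (c *m A^T)^T) 0 0).
    rewrite trmx_mul trmxK mulmxA mxE.
    by apply: eq_bigr => j _; rewrite mulrC [c^T _ _]mxE.
  by rewrite cA trmx0 mulmx0 mxE.
have rA : \rank A = m by exact/eqP.
split=> [|Tinj]; first by rewrite -rA rank_leq_row.
have Afree : row_free A.
  apply: inj_row_free => c cA.
  have : T (\sum_(j < n) c 0 j *: e j) = T 0.
    rewrite TA linear0 -[RHS]cA; congr (_ *m _).
    by apply/rowP => j; rewrite mxE.
  move=> /Tinj s0; have [d [_ du]] := eP 0.
  have := du _ (esym s0).
  have -> : d = fun=> 0 by apply: du; rewrite big1// => j _; rewrite scale0r.
  by move=> c0; apply/rowP => j; rewrite mxE; move/(congr1 (@^~ j)): c0.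
split; last by rewrite -rA; exact/eqP.
rewrite -setTT_bijective; split=> // [x y _ _ /Tinj//|w _].
have /submxP[D wD] : (w <= A)%MS by exact: submx_full.
exists (\sum_(j < n) D 0 j *: e j) => //.
by rewrite TA wD; congr (_ *m _); apply/rowP => j; rewrite mxE.
Qed.

(** * Coordinates of null sequences *)

(** If [u] is nonzero, its entries beyond some index are smaller than half the
    norm, so the supremum is a maximum over finitely many indices. *)
Lemma c0_norm_attained (R : realType) (u : c0 R) : exists i, `|u i| = `|u|.
Proof.
have [->|u0] := eqVneq u 0.
  by exists 0%N; rewrite [in RHS]normr0 normr0.
have u2 : 0 < `|u| / 2 by rewrite divr_gt0// normr_gt0.
have /cvgrPdist_lt/(_ _ u2)[N _ Nu] := @c0_cvg R u.
have tail i : (N <= i)%N -> `|u i| < `|u| / 2.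
  by move=> /Nu /=; rewrite sub0r normrN.
pose j := [arg max_(j > @ord0 N) `|u j|]%O.
exists j; apply/eqP; rewrite eq_le (c0_norm_ge u)/= leNgt; apply/negP => uj.
have : `|u| <= Num.max `|u j| (`|u| / 2).
  apply: c0_norm_le => i; rewrite le_max.
  have [iN|/tail/ltW->] := ltnP i N; last by rewrite orbT.
  rewrite /j; case: arg_maxP => // k _.
  move=> /(_ (Ordinal (ltnW iN : i < N.+1)%N) isT) /= ik.
  by apply/orP; left.
by rewrite leNgt gt_max uj ltr_pdivrMr// ltr_pMr ?normr_gt0// ltr1n.
Qed.

Lemma coordinate_c0_linear (R : realType) (i : nat) :
  linear (fun u : c0 R => u i).
Proof. by []. Qed.

Lemma coordinate_c0_le (R : realType) (i : nat) (u : c0 R) :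
  `|u i| <= 1 * `|u|.
Proof. by rewrite mul1r; exact: c0_norm_ge. Qed.

Definition evaluation (R : realType) (i : nat) : dual (c0 R) :=
  mk_dual (@coordinate_c0_linear R i) (@coordinate_c0_le R i).

Lemma evaluation_norm_le1 (R : realType) (i : nat) : `|evaluation R i| <= 1.
Proof. by apply: dual_norm_bound => // u; exact: coordinate_c0_le. Qed.

Lemma unit_null_seq (R : realType) (i : nat) :
  (fun j => (j == i)%:R : R) \in @null_seq R.
Proof.
apply/null_seqP; apply: cvg_near_cst; exists i.+1 => // j /= ij.
by rewrite gtn_eqF.
Qed.

Definition unit_seq (R : realType) (i : nat) : c0 R := C0 (unit_null_seq R i).

(** * The coordinates at which a subspace attains its norm *)

Definition norming_coordinate (R : realType) (Y : submodClosed (c0 R))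
    (i : nat) : Prop :=
  exists2 y : subsp Y, y <> 0 & `|(subsp_val y : c0 R) i| = `|y|.

Lemma norming_coordinate_exists (R : realType) (Y : submodClosed (c0 R))
    (y : subsp Y) :
  y <> 0 ->
  exists2 i, norming_coordinate Y i & `|(subsp_val y : c0 R) i| = `|y|.
Proof.
move=> y0; have [i iE] := c0_norm_attained (subsp_val y : c0 R).
by exists i => //; exists y.
Qed.

(** An evaluation has norm at most 1 on [c0], and a vector of [Y] that attains its
    norm at [i] shows that it still has norm at least 1 on [Y]. *)
Lemma norming_evaluation_in_complement (R : realType)
    (Y : submodClosed (c0 R)) (G : submodClosed (dual (c0 R))) (i : nat) :
  direct_sum [set` G] (annihilator Y) ->
  (forall f g h : dual (c0 R), g \in G -> annihilator Y h -> h <> 0 ->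
     f = g + h -> `|f| > `|g|) ->
  norming_coordinate Y i -> evaluation R i \in G.
Proof.
move=> GY lt [y y0 yi]; apply: (norm_preserving_in_complement GY lt).
rewrite (le_trans (evaluation_norm_le1 R i))//.
have ny : 0 < `|y| by rewrite normr_gt0; apply/eqP.
rewrite -(ler_pM2r ny) mul1r -[leLHS]yi.
exact: (dual_ler_norm (restriction Y (evaluation R i)) y).
Qed.

(** A combination of evaluations that vanishes on [Y] lies both in the complement
    and in the annihilator, so it vanishes on all of [c0], in particular at the
    unit vectors. *)
Lemma norming_coordinates_independent (R : realType)
    (Y : submodClosed (c0 R)) (m : nat) (s : 'I_m -> nat) (c : 'I_m -> R) :
  property_SU Y -> injective s -> (forall k, norming_coordinate Y (s k)) ->
  (forall y : subsp Y, \sum_(k < m) c k * (subsp_val y : c0 R) (s k) = 0) ->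
  forall k, c k = 0.
Proof.
move=> [G [_ GY lt]] sinj sN cY k.
pose h : dual (c0 R) := \sum_(j < m) c j *: evaluation R (s j).
have hE u : h u = \sum_(j < m) c j * u (s j) by exact: dual_sumE.
have h0 : h = 0.
  apply: (complement_annihilator_eq0 GY).
    apply: rpred_sum => j _; apply: rpredZ.
    exact: norming_evaluation_in_complement GY lt (sN j).
  by apply/annihilatorP => y; rewrite hE.
have := hE (unit_seq R (s k)); rewrite h0 (bigD1 k)//= eqxx mulr1 big1.
  by rewrite addr0 => <-.
by move=> j jk; rewrite (inj_eq sinj) (negPf jk) mulr0.
Qed.

Lemma sample_linear (R : realType) (Y : submodClosed (c0 R)) (m : nat)
    (s : 'I_m -> nat) :
  linear (fun y : subsp Y => \row_k (subsp_val y : c0 R) (s k) : 'rV[R]_m).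
Proof. by move=> a y z; apply/rowP => k; rewrite !mxE. Qed.

(** Independence bounds the length of any repetition-free list of norming
    coordinates by [n].  A list of maximal length contains all of them, so it
    sees the norm of every vector of [Y]. *)
Lemma property_SU_norming_coordinates (R : realType) (Y : submodClosed (c0 R))
    (n : nat) :
  has_dim (subsp Y) n -> property_SU Y ->
  exists (s : 'I_n -> nat) (T : {linear subsp Y -> linfty R n}),
    [/\ bijective T, forall y, `|T y| = `|y| &
        forall k (y : subsp Y), (subsp_val y : c0 R) (s k) = T y 0 k].
Proof.
move=> dimY SU.
pose sample m (s : 'I_m -> nat) : {linear subsp Y -> 'rV[R]_m} :=
  HB.pack (fun y : subsp Y => \row_k (subsp_val y : c0 R) (s k) : 'rV[R]_m)
    (GRing.isLinear.Build _ _ _ _ _ (@sample_linear R Y m s)).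
have sampleE m s y k : sample m s y 0 k = (subsp_val y : c0 R) (s k).
  by rewrite mxE.
pose listing m (s : 'I_m -> nat) :=
  injective s /\ forall k, norming_coordinate Y (s k).
have dim_bound m s : listing m s ->
    (m <= n)%N /\ (injective (sample m s) -> bijective (sample m s) /\ m = n).
  move=> [sinj sN]; apply: dim_ge_independent_coordinates dimY _ => c cY.
  apply: (norming_coordinates_independent SU sinj sN) => y.
  by rewrite -[RHS](cY y); apply: eq_bigr => k _; rewrite sampleE.
have ex0 : exists m, `[< exists s, listing m s >].
  by exists 0%N; apply/asboolP; exists (fun=> 0%N); split=> -[].
have bounded m : `[< exists s, listing m s >] -> (m <= n)%N.
  by move=> /asboolP[s /dim_bound[]].
have [m /asboolP[s sl] mmax] := ex_maxnP ex0 bounded.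
have [sinj sN] := sl.
have complete i : norming_coordinate Y i -> exists k, s k = i.
  move=> iN; apply: contrapT => /forallNP si.
  suff : (m.+1 <= m)%N by rewrite ltnn.
  apply: mmax; apply/asboolP.
  (* A norming coordinate missing from the list could be put in front of it. *)
  exists (fun k => if unlift ord0 k is Some k' then s k' else i); split.
    move=> k l; case: unliftP => [k'|] ->; case: unliftP => [l'|] -> //.
    - by move=> /sinj ->.
    - by move=> /si.
    - by move=> /esym/si.
  by move=> k; case: unliftP => [k'|] _.
have iso y : `|sample m s y| = `|y|.
  apply/eqP; rewrite eq_le row_norm_le//=; last first.
    by move=> k; rewrite sampleE; exact: (c0_norm_ge (subsp_val y : c0 R)).
  have [->|/eqP y0] := eqVneq y 0; first by rewrite normr0.
  have [i /complete[k <-] <-] := norming_coordinate_exists y0.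
  by rewrite -sampleE; exact: row_norm_ge.
have Tinj : injective (sample m s).
  move=> y z yz; apply/eqP; rewrite -subr_eq0 -normr_eq0 -iso linearB yz.
  by rewrite subrr normr0.
have [bij mn] := (dim_bound m s sl).2 Tinj.
case: n / mn {dimY dim_bound bounded mmax} => //.
by exists s, (sample m s); split=> // k y; rewrite sampleE.
Qed.

Theorem theorem3p2 (R : realType) (Y : submodClosed (c0 R)) (n : nat)
    (dimY : has_dim (subsp Y) n) :
  property_SU Y <->
  (property_U Y /\ isometrically_isomorphic (subsp Y) (linfty R n)).
Proof.
split=> [SU|[YU Yiso]]; last exact: property_U_linfty_SU YU Yiso.
have [s [T [Tbij Tiso sT]]] := property_SU_norming_coordinates dimY SU.
split; last by exists T.
have [L [Lext Lle]] := linfty_linear_extension Tbij Tiso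
  (fun k => evaluation_norm_le1 R (s k)) sT.
by apply: property_SU_U SU _ => f; exists (L f).
Qed.
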